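(* Let $\mathcal{R}_{2k}(q)=(q)_\infty R_{2k}(q)$ for $k\ge1$, where $R_{2k}(q)$ is the $2k$-th rank moment generating function, let $f_{2k}$ be the mock Eisenstein series attached to the rank generating function, and let $G_{2k}$ be the Eisenstein series. Then $$\mathbb{Q}[\mathcal{R}_2,\mathcal{R}_4,\ldots,G_2,G_4,\ldots]=\mathbb{Q}[f_2,f_4,\ldots,G_2,G_4,\ldots].$$
   Context: Here $q=e^{2\pi i\tau}$ with $\mathrm{Im}(\tau)>0$, $\zeta=e^{2\pi iz}$, $(a)_n=\prod_{j=1}^n(1-aq^{j-1})$ for $n\in\mathbb{N}_0\cup\{\infty\}$. The rank of a partition is its largest part minus its number of parts (the empty partition has rank $0$); $N(m,n)$ is the number of partitions of $n$ with rank $m$, with generating function $$R(\zeta;q)=\sum_{m\in\mathbb{Z},\,n\ge0}N(m,n)\zeta^mq^n=\sum_{n\ge0}\frac{q^{n^2}}{(\zeta q)_n(\zeta^{-1}q)_n},$$ and $R_k(q)=\sum_{n\ge0}\sum_{m\in\mathbb{Z}}m^kN(m,n)q^n$. The mock Eisenstein series $f_k(\tau)$, $k\ge1$, are defined by the expansion in powers of $z$ $$R(\zeta;q)=\frac{\sin(\pi z)}{\pi z\,(q)_\infty}\exp\left(2\sum_{k\ge1}f_k(\tau)\frac{(2\pi iz)^k}{k!}\right).$$ The Eisenstein series are $G_{2k}(\tau)=-\frac{B_{2k}}{4k}+\sum_{n\ge1}\sigma_{2k-1}(n)q^n$, with $B_n$ the $n$-th Bernoulli number and $\sigma_j(n)=\sum_{d\mid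 n}d^j$. Both algebras are the $\mathbb{Q}$-subalgebras generated by the indicated $q$-series. *)

(* Defs.v *)
From HB Require Import structures.
From mathcomp Require Import all_boot all_order all_algebra.
From mathcomp Require Import finmap complex.
From mathcomp Require Import all_classical all_reals trigo.

Set Implicit Arguments.
Unset Strict Implicit.
Unset Printing Implicit Defensive.

Import GRing.Theory.
Local Open Scope classical_set_scope.
Local Open Scope ring_scope.

(* Formal power series over a commutative ring. An iterated series type       *)
(* fps (fps A) is a ring of series in two variables: the outer constructor is *)
(* the outer variable, so C[[q]][[z]] is fps (fps C) with q innermost.        *)
Record fps (A : Type) := Fps { fcoef : nat -> A }.

HB.instance Definition _ (A : Type) := gen_eqMixin (fps A).
HB.instance Definition _ (A : Type) := gen_choiceMixin (fps A).

Lemma fpsP (A : Type) (p q : fps A) : (forall n, fcoef p n = fcoef q n) -> p = q.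
Proof. by case: p q => [p] [q] /= pq; congr Fps; apply/funext. Qed.

Section FpsRing.
Variable A : comNzRingType.
Implicit Types p q r : fps A.

Definition fpsC (a : A) : fps A := Fps (fun n => if n is 0 then a else 0).
Definition fpsX : fps A := Fps (fun n => (n == 1)%:R).
Definition fps_opp p := Fps (fun n => - fcoef p n).
Definition fps_add p q := Fps (fun n => fcoef p n + fcoef q n).
Definition fps_mul p q :=
  Fps (fun n => \sum_(i < n.+1) fcoef p i * fcoef q (n - i)).

Fact fps_addA : associative fps_add.
Proof. by move=> p q r; apply: fpsP => n /=; rewrite addrA. Qed.
Fact fps_addC : commutative fps_add.
Proof. by move=> p q; apply: fpsP => n /=; rewrite addrC. Qed.
Fact fps_add0 : left_id (fpsC 0) fps_add.
Proof. by move=> p; apply: fpsP => -[|n] /=; rewrite add0r. Qed.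
Fact fps_addN : left_inverse (fpsC 0) fps_opp fps_add.
Proof. by move=> p; apply: fpsP => -[|n] /=; rewrite addNr. Qed.

HB.instance Definition _ :=
  GRing.isZmodule.Build (fps A) fps_addA fps_addC fps_add0 fps_addN.

Let trunc n p : {poly A} := \poly_(i < n) fcoef p i.

Let coefM_trunc n p q (u v : {poly A}) :
  (forall i, (i <= n)%N -> fcoef p i = u`_i) ->
  (forall i, (i <= n)%N -> fcoef q i = v`_i) ->
  forall i, (i <= n)%N -> fcoef (fps_mul p q) i = (u * v)`_i.
Proof.
move=> pu qv i le_in; rewrite coefM; apply: eq_bigr => j _.
have le_ji : (j <= i)%N by rewrite -ltnS.
by rewrite pu ?qv // (leq_trans _ le_in) // leq_subr.
Qed.

Let truncE n p i : (i <= n)%N -> fcoef p i = (trunc n.+1 p)`_i.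
Proof. by move=> le_in; rewrite coef_poly ltnS le_in. Qed.

Fact fps_mulA : associative fps_mul.
Proof.
move=> p q r; apply: fpsP => n; have T := @truncE n.
rewrite (coefM_trunc (T p) (coefM_trunc (T q) (T r)) (leqnn n)).
by rewrite (coefM_trunc (coefM_trunc (T p) (T q)) (T r) (leqnn n)) mulrA.
Qed.
Fact fps_mulC : commutative fps_mul.
Proof.
move=> p q; apply: fpsP => n; have T := @truncE n.
rewrite (coefM_trunc (T p) (T q) (leqnn n)).
by rewrite (coefM_trunc (T q) (T p) (leqnn n)) mulrC.
Qed.
Fact fps_mul1 : left_id (fpsC 1) fps_mul.
Proof.
move=> p; apply: fpsP => n /=.
by rewrite big_ord_recl /= mul1r subn0 big1 ?addr0 // => i _; rewrite mul0r.
Qed.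
Fact fps_mulDl : left_distributive fps_mul fps_add.
Proof.
move=> p q r; apply: fpsP => n /=; rewrite -big_split /=.
by apply: eq_bigr => i _; rewrite mulrDl.
Qed.
Fact fps_oner_neq0 : fpsC 1 != 0 :> fps A.
Proof.
by apply/eqP => /(congr1 (fun p => fcoef p 0)) /= /eqP; rewrite oner_eq0.
Qed.

HB.instance Definition _ := GRing.Zmodule_isComNzRing.Build (fps A)
  fps_mulA fps_mulC fps_mul1 fps_mulDl fps_oner_neq0.

Definition fps_unit : pred (fps A) := fun p => `[< exists q, q * p = 1 >].
Definition fps_inv p : fps A :=
  if pselect (exists q, q * p = 1) is left ex then projT1 (cid ex) else p.

Fact fps_mulV : {in fps_unit, left_inverse 1 fps_inv *%R}.
Proof.
move=> p /asboolP ex; rewrite /fps_inv; case: pselect => // ex'.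
exact: (projT2 (cid ex')).
Qed.
Fact fps_intro_unit p q : q * p = 1 -> p \in fps_unit.
Proof. by move=> qp; apply/asboolP; exists q. Qed.
Fact fps_inv_out : {in [predC fps_unit], fps_inv =1 id}.
Proof. by move=> p /asboolP nex; rewrite /fps_inv; case: pselect. Qed.

HB.instance Definition _ := GRing.ComNzRing_hasMulInverse.Build (fps A)
  fps_mulV fps_intro_unit fps_inv_out.

(* Infinite sum of the u i, for a family such that u i has order at least i   *)
(* (otherwise the truncation below is not the sum).                           *)
Definition fps_sum (u : nat -> fps A) : fps A :=
  Fps (fun n => \sum_(i < n.+1) fcoef (u i) n).

(* Exchange of the two variables: A[[x]][[y]] -> A[[y]][[x]].                 *)
Definition fps_swap (p : fps (fps A)) : fps (fps A) :=
  Fps (fun i => Fps (fun j => fcoef (fcoef p j) i)).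

(* The q-Pochhammer symbols, q being the variable. Since                      *)
(* (a)_N = (a)_(n+1) mod q^(n+1) for N > n, the coefficients of (a)_oo are    *)
(* read off the finite products.                                              *)
Definition qpoch (a : fps A) (n : nat) : fps A :=
  \prod_(1 <= j < n.+1) (1 - a * fpsX ^+ j.-1).
Definition qpoch_inf (a : fps A) : fps A :=
  Fps (fun n => fcoef (qpoch a n.+1) n).

End FpsRing.

Arguments fpsX {A}.

(* Exponential and sine of a series g without constant term.                  *)
Definition fps_exp (A : comUnitRingType) (g : fps A) : fps A :=
  fps_sum (fun i => fpsC (i`!%:R^-1) * g ^+ i).
Definition fps_sin (A : comUnitRingType) (g : fps A) : fps A :=
  fps_sum (fun i => fpsC ((-1) ^+ i / (2 * i).+1`!%:R) * g ^+ (2 * i).+1).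

Definition is_partition (n : nat) (s : seq nat) : bool :=
  [&& sorted geq s, all (leq 1) s & sumn s == n].

(* The parts are listed in decreasing order, so the head is the largest one.  *)
Definition rank (s : seq nat) : int := (head 0 s)%:Z - (size s)%:Z.

Definition rank_count (m : int) (n : nat) : nat :=
  #|` fset_set [set s : seq nat | is_partition n s /\ rank s = m]|.

(* bernoulli_seq n = [:: B_0; ...; B_(n-1)], from the recurrence              *)
(* \sum_(j <= n) 'C(n + 1, j) B_j = 0 for n > 0, rewritten with               *)
(* 'C(n + 1, j) / (n + 1) = 'C(n, j) / (n - j + 1).                           *)
Fixpoint bernoulli_seq (n : nat) : seq rat :=
  if n is m.+1 then
    let s := bernoulli_seq m in
    rcons s ((m == 0)%:R
             - \sum_(j < m) 'C(m, j)%:R * s`_j / (m - j).+1%:R)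
  else [::].
Definition bernoulli (n : nat) : rat := (bernoulli_seq n.+1)`_n.

Definition sigma (j n : nat) : nat := \sum_(d <- divisors n) d ^ j.

Section QSeries.
Variable R : realType.
Local Notation C := R[i].

Definition piC : C := (pi : R)%:C%C.

(* (q)_oo *)
Definition euler_q : fps C := qpoch_inf fpsX.

(* zeta = e^(2 pi i z) in C[[z]] *)
Definition zeta : fps C := fps_exp (fpsC (2 * piC * 'i) * fpsX).

(* R(zeta; q), as an element of C[[z]][[q]] *)
Definition rank_gf : fps (fps C) :=
  Fps (fun n => \sum_(m \in [set: int]) (rank_count m n)%:R * zeta ^ m).

Definition rank_moment_gf (k : nat) : fps C :=
  Fps (fun n => \sum_(m \in [set: int]) (m%:~R : C) ^+ k * (rank_count m n)%:R).

(* The defining expansion of the f_k (k >= 1; f 0 is irrelevant), an identity *)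
(* in C[[q]][[z]], with the denominator pi z (q)_oo cleared: it is not a zero *)
(* divisor there, but z has no inverse. It determines every f_k with k >= 1.  *)
Definition is_mock_eisenstein (f : nat -> fps C) : Prop :=
  fpsC (fpsC piC) * fpsX * fpsC euler_q * fps_swap rank_gf =
  fps_sin (fpsC (fpsC piC) * fpsX) *
  fps_exp (2 * fps_sum (fun k => if k is 0 then 0 else
    fpsC (f k / k`!%:R) * (fpsC (fpsC (2 * piC * 'i)) * fpsX) ^+ k)).

(* For even k > 0: G_k = - B_k / (2 k) + \sum_(n >= 1) sigma_(k-1)(n) q^n.    *)
Definition eisenstein (k : nat) : fps C :=
  Fps (fun n => if n is 0 then ratr (- bernoulli k / (2 * k)%N%:R)
                else (sigma k.-1 n)%:R).

Definition normalized_rank_moment (k : nat) : fps C :=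
  euler_q * rank_moment_gf k.

Definition is_Qsubalgebra (S : set (fps C)) : Prop :=
  [/\ S 1,
      forall (a : rat) u v, S u -> S v -> S (fpsC (ratr a) * u + v)
    & forall u v, S u -> S v -> S (u * v)].

Definition Qalgebra (X : set (fps C)) : set (fps C) :=
  smallest is_Qsubalgebra X.

End QSeries.

(* Main.v *)
Require Import Defs.
From HB Require Import structures.
From mathcomp Require Import all_boot all_order all_algebra.
From mathcomp Require Import finmap complex ring zify.
From mathcomp Require Import all_classical all_reals trigo.

Set Implicit Arguments.
Unset Strict Implicit.
Unset Printing Implicit Defensive.

Import Order.TTheory GRing.Theory Num.Theory.

(* In the variable w = 2 pi i z the defining expansion of the f_k reads       *)
(*   \sum_k (q)_oo R_k w^k / k! =                                             *)
(*     sinh(w/2) / (w/2) * exp(2 \sum_k f_k w^k / k!),                        *)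
(* where the first factor on the right is even with rational coefficients and *)
(* constant term 1. Conjugation of partitions gives N(-m, n) = N(m, n), so    *)
(* the left-hand side is even. For a Q-subalgebra S, call a series in w       *)
(* graded if its odd coefficients vanish and its even ones lie in S. A series *)
(* without constant term is graded iff its exponential is, and multiplication *)
(* by sinh(w/2) / (w/2) preserves and reflects gradedness. Hence S contains   *)
(* all the (q)_oo R_2k iff it contains all the f_2k, the odd f_k being zero   *)
(* by the case where S is everything.                                         *)

(** Moments and mock Eisenstein series determine each other by a triangular recursion over the
    rationals: the degree n coefficient of an exponential is that of the exponent plus a rational
    polynomial in its lower coefficients ([grading_fcoef_expB]), so gradedness passes both ways
    ([graded_exp]), and a graded factor with constant term 1 can be cancelled in the same manner
    ([gradedMr]). Together with the vanishing of odd moments ([odd_rank_moment_gf]) this gives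
    [Qsubalg_rank_moment_mock]: a Q-subalgebra contains one family iff it contains the other.
    Applied to the algebra generated on either side, it yields both inclusions. *)

Definition conj_partition (s : seq nat) : seq nat :=
  mkseq (fun i => count (fun x => i < x) s) (head 0 s).

Lemma path_geq_le a (s : seq nat) x : path geq a s -> x \in s -> x <= a.
Proof.
by rewrite (path_sortedE (rev_trans leq_trans)) => /andP[/allP h _] /h.
Qed.

Lemma sorted_geq_head (s : seq nat) x : sorted geq s -> x \in s -> x <= head 0 s.
Proof.
by case: s => //= a s hs; rewrite inE => /predU1P[->|/(path_geq_le hs)].
Qed.

(** The parts exceeding [j] form an initial segment of [s]. Both sides say that the cell (i, j) lies
    in the Young diagram, read by columns and by rows; the default 0 of [nth] covers rows past the
    end. *)
Lemma ltn_count_nth (s : seq nat) i j : sorted geq s ->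
  (i < count (fun x => j < x) s) = (j < nth 0 s i).
Proof.
elim: s i => [|a s IH] i hs /=; first by rewrite nth_nil ltn0.
have hs' := path_sorted hs; have [haj|haj] := ltnP j a.
  by case: i => [|i] /=; rewrite ?haj // add1n ltnS IH.
have sj x : x \in s -> x <= j by move=> /(path_geq_le hs)/leq_trans; apply.
have /eqP-> : count (fun x => j < x) s == 0.
  by rewrite eqn0Ngt -has_count; apply/hasPn => x /sj; rewrite leqNgt.
rewrite ltn0; apply/esym/negbTE; rewrite -leqNgt; case: i => //= i.
have [si|si] := ltnP i (size s); first exact/sj/mem_nth.
by rewrite nth_default.
Qed.

Lemma size_conj_partition s : size (conj_partition s) = head 0 s.
Proof. by rewrite size_mkseq. Qed.

Lemma head_conj_partition n s : is_partition n s -> head 0 (conj_partition s) = size s.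
Proof.
case/and3P=> _ h1 _; rewrite -nth0 /conj_partition.
case: s h1 => //= a s /andP[a0 h1]; rewrite nth_mkseq //= a0.
by congr (_ + _); apply/eqP; rewrite -all_count; exact: h1.
Qed.

Lemma nth_conj_partition s i : sorted geq s ->
  nth 0 (conj_partition s) i = count (fun x => i < x) s.
Proof.
move=> hs; rewrite /conj_partition; have [h|h] := ltnP i (head 0 s).
  by rewrite nth_mkseq.
rewrite nth_default ?size_mkseq //; apply/esym/eqP.
by rewrite eqn0Ngt ltn_count_nth // nth0 -leqNgt.
Qed.

Lemma count_ltn_iota x n : x <= n -> count (fun i => i < x) (iota 0 n) = x.
Proof.
move=> xn; rewrite -(subnKC xn) iotaD count_cat add0n.
have /eqP-> : count (fun i => i < x) (iota x (n - x)) == 0.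
  rewrite eqn0Ngt -has_count; apply/hasPn => i.
  by rewrite mem_iota -leqNgt => /andP[].
rewrite addn0 -[RHS](size_iota 0) -[RHS]addn0; apply/eqP.
rewrite addn0 -all_count; by apply/allP => i; rewrite mem_iota.
Qed.

Lemma sumn_conj_partition s : sorted geq s -> sumn (conj_partition s) = sumn s.
Proof.
move=> hs; rewrite /conj_partition sumnE big_map.
under eq_bigr do rewrite -sum1_count big_mkcond.
rewrite exchange_big sumnE /= [LHS]big_seq [RHS]big_seq; apply: eq_bigr => x xs.
by rewrite -big_mkcond sum1_count count_ltn_iota // sorted_geq_head.
Qed.

Lemma is_partition_conj n s : is_partition n s -> is_partition n (conj_partition s).
Proof.
move=> /and3P[hs h1 /eqP hn]; apply/and3P; split; last 1 first.
- by rewrite sumn_conj_partition // hn.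
- rewrite sorted_map; apply: sub_sorted (iota_sorted 0 _) => i j ij /=.
  by apply: sub_count => x /=; apply: leq_ltn_trans.
apply/allP => _ /mapP[i + ->]; rewrite mem_iota add0n => /= ih.
by rewrite ltn_count_nth // nth0.
Qed.

Lemma conj_partitionK n s : is_partition n s -> conj_partition (conj_partition s) = s.
Proof.
move=> ps; have pc := is_partition_conj ps.
have [/and3P[hs _ _] /and3P[hc _ _]] := (ps, pc).
have sz : size (conj_partition (conj_partition s)) = size s.
  by rewrite size_conj_partition (head_conj_partition ps).
apply: (@eq_from_nth _ 0) => // i _; rewrite nth_conj_partition //.
(* Transposing the diagram twice: two numbers with the same smaller numbers are equal. *)
have H j : (j < count (fun x => i < x) (conj_partition s)) = (j < nth 0 s i).
  by rewrite ltn_count_nth // nth_conj_partition // ltn_count_nth.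
apply/eqP; rewrite eqn_leq; apply/andP; split; rewrite leqNgt; first by rewrite H ltnn.
by rewrite -H ltnn.
Qed.

Lemma rank_conj_partition n s : is_partition n s ->
  rank (conj_partition s) = (- rank s)%R.
Proof.
by move=> ps; rewrite /rank (head_conj_partition ps) size_conj_partition GRing.opprB.
Qed.

Local Open Scope classical_set_scope.

Lemma rank_countN (m : int) n : rank_count (- m)%R n = rank_count m n.
Proof.
pose P (m : int) := [set s : seq nat | is_partition n s /\ rank s = m].
have sub k : conj_partition @` P k `<=` P (- k)%R.
  move=> _ [s [ps <-] <-]; split; first exact: is_partition_conj.
  exact: rank_conj_partition ps.
have PE k : P (- k)%R = conj_partition @` P k.
  apply/seteqP; split; last exact: sub.
  move=> s [ps rs]; exists (conj_partition s); last exact: conj_partitionK ps.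
  split; first exact: is_partition_conj.
  by rewrite (rank_conj_partition ps) rs GRing.opprK.
rewrite /rank_count -!/(P _); have [fin|inf] := pselect (finite_set (P m)).
  rewrite PE fset_set_image // card_in_imfset // => s t.
  rewrite !in_fset_set // !inE => -[ps _] [pt _] e.
  by rewrite -(conj_partitionK ps) e (conj_partitionK pt).
(* If [P m] were infinite, so would be [P (- m)], and [fset_set] would return the empty default for
   both. *)
rewrite /fset_set; case: pselect => [h|_].
  by case: inf; rewrite -[m]GRing.opprK PE; apply: finite_image.
by case: pselect => // h; case: inf.
Qed.

(** The largest part and the number of parts both lie between 0 and n. This makes the sums over all
    ranks finite. *)
Lemma rank_count_eq0 (m : int) n : (n < `|m|)%N -> rank_count m n = 0%N.
Proof.
move=> mn; rewrite /rank_count (_ : [set s | _] = set0) ?fset_set0 //.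
rewrite -subset0 => s [/and3P[hs h1 /eqP hn] hm].
have h : head 0 s <= n by rewrite -hn; case: s {hs h1 hn hm} => //= *; apply: leq_addr.
have k : size s <= n.
  by rewrite -hn; elim: s h1 {hs hn hm h} => //= a s IH /andP[a1 /IH]; lia.
by move: hm mn; rewrite /rank; move: (head 0 s) (size s) h k => a b; lia.
Qed.

Local Open Scope ring_scope.

(** * Coefficients of formal power series *)

Section FpsTheory.
Variable A : comNzRingType.
Implicit Types p q r : fps A.

Lemma fcoefD p q n : fcoef (p + q) n = fcoef p n + fcoef q n.
Proof. by []. Qed.

Lemma fcoefM p q n :
  fcoef (p * q) n = \sum_(i < n.+1) fcoef p i * fcoef q (n - i).
Proof. by []. Qed.

Lemma fcoef0 n : fcoef (0 : fps A) n = 0.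
Proof. by case: n. Qed.

Lemma fcoef1 n : fcoef (1 : fps A) n = (n == 0)%:R.
Proof. by case: n. Qed.

Lemma fcoef_sum I (s : seq I) (P : pred I) (F : I -> fps A) n :
  fcoef (\sum_(i <- s | P i) F i) n = \sum_(i <- s | P i) fcoef (F i) n.
Proof.
apply: (big_morph (fun p => fcoef p n)) => [p q|]; [exact: fcoefD|exact: fcoef0].
Qed.

Lemma fcoefCM (a : A) p n : fcoef (fpsC a * p) n = a * fcoef p n.
Proof.
rewrite fcoefM big_ord_recl subn0 big1 ?addr0 // => i _ /=.
by rewrite mul0r.
Qed.

Lemma fcoefXM p n : fcoef (fpsX * p) n = if n is m.+1 then fcoef p m else 0.
Proof.
case: n => [|n]; rewrite fcoefM; first by rewrite big_ord1 mul0r.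
rewrite 2!big_ord_recl /= mul0r add0r mul1r subSS subn0 big1 ?addr0 // => i _.
by rewrite mul0r.
Qed.

Lemma fcoefXn k n : fcoef (fpsX ^+ k : fps A) n = (n == k)%:R.
Proof.
elim: k n => [|k IH] n; first exact: fcoef1.
by rewrite exprS fcoefXM; case: n.
Qed.

Fact fpsC_is_zmod_morphism : zmod_morphism (@fpsC A).
Proof. by move=> a b; apply: fpsP => -[|n] //=; rewrite subr0. Qed.

Fact fpsC_is_monoid_morphism : monoid_morphism (@fpsC A).
Proof.
split=> // a b; apply: fpsP => n; rewrite fcoefCM.
by case: n => //= n; rewrite mulr0.
Qed.

HB.instance Definition _ :=
  GRing.isZmodMorphism.Build A (fps A) (@fpsC A) fpsC_is_zmod_morphism.
HB.instance Definition _ :=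
  GRing.isMonoidMorphism.Build A (fps A) (@fpsC A) fpsC_is_monoid_morphism.

Lemma fpsCM (a b : A) : fpsC (a * b) = fpsC a * fpsC b.
Proof. exact: rmorphM. Qed.

Lemma fcoefCXn (a : A) k n : fcoef ((fpsC a * fpsX) ^+ k) n = a ^+ k * (n == k)%:R.
Proof. by rewrite exprMn -(rmorphXn (@fpsC A)) fcoefCM fcoefXn. Qed.

End FpsTheory.

Lemma fcoef_fps_sum (A : comUnitRingType) (u : nat -> fps A) n :
  fcoef (fps_sum u) n = \sum_(i < n.+1) fcoef (u i) n.
Proof. by []. Qed.

Lemma fcoef_sin (A : comUnitRingType) (G : fps A) n :
  fcoef (fps_sin G) n =
  \sum_(i < n.+1) (-1) ^+ i / (2 * i).+1`!%:R * fcoef (G ^+ (2 * i).+1) n.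
Proof. by apply: eq_bigr => i _; rewrite fcoefCM. Qed.

Lemma fcoef_exp (A : comUnitRingType) (G : fps A) n :
  fcoef (fps_exp G) n = \sum_(i < n.+1) i`!%:R^-1 * fcoef (G ^+ i) n.
Proof. by apply: eq_bigr => i _; rewrite fcoefCM. Qed.

(** * Conditions on coefficients that are stable under products and exponentials *)

(** [T n] is the condition imposed on a coefficient of degree n; [grading_fact] serves the
    denominators of the exponential. *)
Record grading (A : comUnitRingType) (T : nat -> set A) : Prop := Grading {
  grading0 : forall n, T n 0;
  grading1 : T 0 1;
  gradingB : forall n u v, T n u -> T n v -> T n (u - v);
  gradingM : forall m n u v, T m u -> T n v -> T (m + n)%N (u * v);
  grading_fact : forall i n u, T n u -> T n (i`!%:R^-1 * u) }.

Section Grading.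
Variables (A : comUnitRingType) (T : nat -> set A).
Hypothesis gT : grading T.
Implicit Types p q D E G : fps A.

Definition graded p := forall n, T n (fcoef p n).

Lemma gradingN n u : T n u -> T n (- u).
Proof. by move=> Tu; rewrite -sub0r; apply: gradingB => //; apply: grading0. Qed.

Lemma gradingD n u v : T n u -> T n v -> T n (u + v).
Proof. by move=> Tu Tv; rewrite -[v]opprK; apply: gradingB => //; apply: gradingN. Qed.

Lemma grading_sum n I (s : seq I) (P : pred I) (F : I -> A) :
  (forall i, P i -> T n (F i)) -> T n (\sum_(i <- s | P i) F i).
Proof. by move=> TF; elim/big_ind: _ => //; [exact: grading0|exact: gradingD]. Qed.

Lemma grading_subM m n u v : (m <= n)%N -> T m u -> T (n - m)%N v -> T n (u * v).
Proof. by move=> mn Tu Tv; rewrite -(subnKC mn); apply: gradingM. Qed.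

Lemma grading_fcoefM p q n :
  (forall i, (i <= n)%N -> T i (fcoef p i)) ->
  (forall i, (i <= n)%N -> T i (fcoef q i)) -> T n (fcoef (p * q) n).
Proof.
move=> Tp Tq; apply: grading_sum => -[i /= i_n] _.
by apply: (@grading_subM i) => //; [apply: Tp|apply/Tq/leq_subr].
Qed.

Lemma gradedM p q : graded p -> graded q -> graded (p * q).
Proof. by move=> Tp Tq n; apply: grading_fcoefM. Qed.

(** The degree n coefficient of [D * E] is that of [E] plus terms in lower coefficients of [E],
    which allows strong induction. *)
Lemma gradedMr D E : fcoef D 0 = 1 -> graded D -> graded (D * E) -> graded E.
Proof.
move=> D0 TD TDE; elim/ltn_ind => n IH.
have := TDE n; rewrite fcoefM big_ord_recl D0 mul1r subn0 => TDEn.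
rewrite -[fcoef E n](addrK (\sum_(i < n) fcoef D (bump 0 i) * fcoef E (n - bump 0 i))).
apply: gradingB => //; apply: grading_sum => -[i i_n] _ /=; rewrite /bump /= add1n.
apply: (grading_subM i_n) => //; by apply: IH; rewrite ltn_subrL (leq_ltn_trans _ i_n).
Qed.

Lemma fcoef0X G i : fcoef G 0 = 0 -> fcoef (G ^+ i.+1) 0 = 0.
Proof. by move=> G0; rewrite exprS fcoefM big_ord1 G0 mul0r. Qed.

(* The terms (G ^ i) / i! with i >= 2 involve only the coefficients of G of    *)
(* degree less than n.                                                         *)
Lemma grading_fcoef_expB G n : fcoef G 0 = 0 ->
  (forall j, (j < n)%N -> T j (fcoef G j)) -> (0 < n)%N ->
  T n (fcoef (fps_exp G) n - fcoef G n).
Proof.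
move=> G0 TG; case: n TG => // n TG _.
have TX i m : (m < n.+1)%N -> T m (fcoef (G ^+ i) m).
  elim: i m => [|i IH] m m_n.
    by case: m {m_n} => [|m]; [exact: grading1|exact: grading0].
  rewrite exprS; apply: grading_fcoefM => j j_m; [apply: TG|apply: IH];
    exact: leq_ltn_trans j_m m_n.
(* In the Cauchy product of [G] and [G ^+ i.+1] both end terms vanish, the constant terms being 0;
   only degrees at most [n] remain. *)
have TX2 i : T n.+1 (fcoef (G ^+ i.+2) n.+1).
  rewrite exprS fcoefM big_ord_recl G0 mul0r add0r.
  rewrite big_ord_recr /= /bump /= add1n subnn fcoef0X // mulr0 addr0.
  apply: grading_sum => -[j j_n] _ /=.
  rewrite add1n; apply: (@grading_subM j.+1) => //; [exact: leqW|exact: TG|].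
  by apply: TX; rewrite subSS ltnS leq_subr.
rewrite fcoef_exp 2!big_ord_recl expr0 fcoef1 mulr0 add0r expr1.
rewrite invr1 mul1r addrC addKr.
by apply: grading_sum => i _; apply: (grading_fact gT); apply: TX2.
Qed.

Lemma fcoef_exp0 G : fcoef (fps_exp G) 0 = 1.
Proof. by rewrite fcoef_exp big_ord1 expr0 invr1 mulr1. Qed.

Lemma graded_exp G : fcoef G 0 = 0 -> graded (fps_exp G) <-> graded G.
Proof.
move=> G0; split=> [TE|TG] n.
  elim/ltn_ind: n => -[|n] IH; first by rewrite G0; apply: grading0.
  have TB := grading_fcoef_expB G0 IH (ltn0Sn n).
  by rewrite -[fcoef G _](subKr (fcoef (fps_exp G) n.+1)); apply: gradingB.
case: n => [|n]; first by rewrite fcoef_exp0; apply: grading1.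
rewrite -[fcoef _ _](subrK (fcoef G n.+1)); apply: gradingD => //.
by apply: grading_fcoef_expB.
Qed.

End Grading.

(** * The series exp(aX) over a field of characteristic 0 *)

Section Exponential.
Variable F : numFieldType.
Implicit Types a b : F.

Lemma natf_fact_neq0 n : n`!%:R != 0 :> F.
Proof. by rewrite pnatr_eq0 -lt0n fact_gt0. Qed.

Lemma fpsC_invn n : (n%:R : fps F)^-1 = fpsC (n%:R^-1).
Proof.
have [->|n0] := eqVneq n 0%N; first by rewrite !invr0 rmorph0.
by rewrite rmorphV ?unitfE ?pnatr_eq0 // rmorph_nat.
Qed.

Definition fps_expC a : fps F := Fps (fun k => a ^+ k / k`!%:R).

Lemma fps_expCE a : fps_exp (fpsC a * fpsX) = fps_expC a.
Proof.
apply: fpsP => n; rewrite fcoef_exp big_ord_recr /= big1 ?add0r => [|i _].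
  by rewrite fcoefCXn eqxx mulr1 mulrC.
by rewrite fcoefCXn gtn_eqF ?mulr0.
Qed.

Lemma fps_expC0 : fps_expC 0 = 1.
Proof.
apply: fpsP => -[|n]; rewrite fcoef1 /=; first by rewrite expr0 mul1r invr1.
by rewrite expr0n mul0r.
Qed.

(** The binomial theorem divided by n!. *)
Lemma fps_expCD a b : fps_expC (a + b) = fps_expC a * fps_expC b.
Proof.
apply: fpsP => n; rewrite fcoefM /= addrC exprDn mulr_suml.
apply: eq_bigr => -[i /= i_n] _.
have i_le : (i <= n)%N by [].
have := natf_fact_neq0; move: (bin_fact i_le) => /(congr1 (fun n => n%:R : F)).
rewrite !natrM -mulr_natl => <- f0.
have bin0 : 'C(n, i)%:R != 0 :> F by rewrite pnatr_eq0 -lt0n bin_gt0.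
by field; rewrite !f0 bin0.
Qed.

Lemma fps_expCXn a n : fps_expC a ^+ n = fps_expC (n%:R * a).
Proof.
elim: n => [|n IH]; first by rewrite mul0r fps_expC0.
by rewrite exprS IH -fps_expCD -natr1 mulrDl mul1r addrC.
Qed.

Lemma fps_expCV a : (fps_expC a)^-1 = fps_expC (- a).
Proof. by apply: mulr1_eq; rewrite -fps_expCD subrr fps_expC0. Qed.

Lemma fps_expCXz a (m : int) : fps_expC a ^ m = fps_expC (m%:~R * a).
Proof.
case: m => n; first by rewrite -exprnP fps_expCXn.
by rewrite NegzE -exprnN -exprVn fps_expCV fps_expCXn mulrN mulrNz mulNr.
Qed.

End Exponential.

Lemma fsbig_int_bound (V : nmodType) n (F : int -> V) :
  (forall m : int, (n < `|m|)%N -> F m = 0) ->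
  \sum_(m \in [set: int]) F m =
  \sum_(m <- [fset (i%:Z - n%:Z) | i in iota 0 (n + n)%N.+1]%fset) F m.
Proof.
move=> F0; apply: fsbigTE => m mB; apply: F0; rewrite ltnNge; apply: contra mB => mn.
apply/imfsetP; exists `|(m + n%:Z)%R|%N; last by lia.
by rewrite inE mem_iota; lia.
Qed.

(** * The rank generating function and the sine factor in terms of w *)

Section MockEisenstein.
Variable R : realType.
Local Notation C := R[i].
Implicit Types S : set (fps C).

Local Notation c := (2 * piC R * 'i).

Lemma piC_neq0 : piC R != 0.
Proof. by rewrite /piC fmorph_eq0 gt_eqF // pi_gt0. Qed.

Lemma c_neq0 : c != 0.
Proof. by rewrite !mulf_neq0 ?piC_neq0 ?neq0Ci ?pnatr_eq0. Qed.

Lemma fcoef_zetaX (m : int) k :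
  fcoef (zeta R ^ m) k = c ^+ k / k`!%:R * m%:~R ^+ k.
Proof. by rewrite /zeta fps_expCE fps_expCXz /= exprMn; ring. Qed.

Lemma rank_gf_summand0 n (m : int) : (n < `|m|)%N ->
  (rank_count m n)%:R * zeta R ^ m = 0.
Proof. by move=> /rank_count_eq0->; rewrite mul0r. Qed.

Lemma rank_moment_summand0 k n (m : int) : (n < `|m|)%N ->
  (m%:~R : C) ^+ k * (rank_count m n)%:R = 0.
Proof. by move=> /rank_count_eq0->; rewrite mulr0. Qed.

(** The coefficient of z^k in [zeta ^ m] is (c m)^k / k!, so collecting the powers of z turns the
    sum over ranks into the k-th moment. *)
Lemma fcoef_rank_gf k :
  fcoef (fps_swap (rank_gf R)) k = fpsC (c ^+ k / k`!%:R) * rank_moment_gf R k.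
Proof.
apply: fpsP => n; rewrite fcoefCM.
rewrite [LHS]/= (fsbig_int_bound (@rank_gf_summand0 n)).
rewrite [in RHS]/= (fsbig_int_bound (@rank_moment_summand0 k n)).
rewrite fcoef_sum mulr_sumr; apply: eq_bigr => m _.
rewrite -(rmorph_nat (@fpsC C)) fcoefCM fcoef_zetaX; ring.
Qed.

Lemma odd_rank_moment_gf k : odd k -> rank_moment_gf R k = 0.
Proof.
move=> ok; apply: fpsP => n; rewrite fcoef0; set s := LHS.
suff: s = - s by move=> /eqP; rewrite -addr_eq0 -mulr2n mulrn_eq0 => /eqP.
rewrite {1}/s /= (reindex_fsbigT (fun m : int => - m)); last first.
  by exists (fun m : int => - m) => m; rewrite opprK.
have H (m : int) : (n < `|m|)%N -> ((- m)%:~R : C) ^+ k * (rank_count (- m) n)%:R = 0.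
  by move=> mn; rewrite rank_moment_summand0 // abszN.
rewrite (fsbig_int_bound H) /s /= (fsbig_int_bound (@rank_moment_summand0 k n)).
rewrite -sumrN; apply: eq_bigr => m _.
by rewrite rank_countN mulrNz exprNn -signr_odd ok mulN1r mulNr.
Qed.

(** This is sin(pi z) / (pi z) = sinh(w/2) / (w/2) with w = [c] z, written so that the coefficient
    of w^n is visibly rational. *)
Definition sinc : fps (fps C) := Fps (fun n =>
  if odd n then 0 else fpsC (c ^+ n * ratr ((2 ^ n * n.+1`!)%N%:R^-1))).

Lemma fps_sinE :
  fps_sin (fpsC (fpsC (piC R)) * fpsX) = fpsC (fpsC (piC R)) * fpsX * sinc.
Proof.
apply: fpsP => n; rewrite -mulrA fcoefCM fcoefXM fcoef_sin.
under eq_bigr do rewrite fcoefCXn.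
case: n => [|n]; first by rewrite big_ord1 /= !mulr0.
rewrite /=.
case: ifP => on.
  rewrite big1 ?mulr0 // => i _; rewrite eqSS; case: eqP => [e|]; last by rewrite !mulr0.
  by have := odd_double i; rewrite -mul2n -e on.
have [m ->] : exists m, n = (2 * m)%N.
  by exists n./2; rewrite mul2n -[LHS]odd_double_half on.
have m_lt : (m < (2 * m).+2)%N by lia.
rewrite (bigD1 (Ordinal m_lt)) //= eqxx mulr1 big1 ?addr0; last first.
  move=> i /eqP im; rewrite eqSS; case: eqP => [e|]; last by rewrite !mulr0.
  by case: im; apply: val_inj => /=; lia.
rewrite fpsC_invn -(rmorph1 (@fpsC C)) -rmorphN -!(rmorphXn (@fpsC C)) -!rmorphM /=.
congr fpsC; rewrite (fmorphV (@ratr C)) rmorph_nat natrM natrX invfM exprS.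
(* The even power of ['i] absorbs the alternating sign of the sine. *)
have -> : c ^+ (2 * m) = (-1) ^+ m * piC R ^+ (2 * m) * 2 ^+ (2 * m).
  by rewrite !exprMn [in 'i ^+ _]exprM sqrCi; ring.
have := natf_fact_neq0 C (2 * m).+1; move: (_%:R) => x x0.
by field; rewrite x0 expf_neq0 ?pnatr_eq0.
Qed.

(** Although z is not invertible, multiplication by it only shifts coefficients; this cancels the
    factor pi z. *)
Lemma fpsCCX_inj (a : C) (p q : fps (fps C)) : a != 0 ->
  fpsC (fpsC a) * fpsX * p = fpsC (fpsC a) * fpsX * q -> p = q.
Proof.
move=> a0 pq; apply: fpsP => n; have /(congr1 (fun p => fcoef p n.+1)) := pq.
rewrite -!mulrA !fcoefCM !fcoefXM => /(congr1 (fun u => fpsC a^-1 * u)).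
by rewrite !mulrA -rmorphM mulVf // rmorph1 !mul1r.
Qed.

(** * The grading attached to a Q-subalgebra *)

Section QsubalgebraTheory.
Variable S : set (fps C).
Hypothesis hS : is_Qsubalgebra S.

Lemma QsubalgB u v : S u -> S v -> S (u - v).
Proof.
move=> Su Sv; case: hS => _ SL _; have := SL (- 1) v u Sv Su.
by rewrite !rmorphN !rmorph1 mulN1r addrC.
Qed.

Lemma Qsubalg0 : S 0.
Proof.
by case: hS => S1 _ _; rewrite -(subrr 1); apply: QsubalgB.
Qed.

Lemma QsubalgZ (a : rat) u : S u -> S (fpsC (ratr a) * u).
Proof.
by move=> Su; rewrite -[X in S X]addr0; case: hS => _ SL _; apply/SL/Qsubalg0.
Qed.

Lemma QsubalgZ_inv (a : rat) u : a != 0 -> S (fpsC (ratr a) * u) -> S u.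
Proof.
move=> a0 /(QsubalgZ a^-1).
by rewrite mulrA -!rmorphM mulVf // !rmorph1 mul1r.
Qed.

(* The coefficient of z^n is (2 pi i)^n times that of w^n. *)
Definition Qdegree n : set (fps C) :=
  [set u | if odd n then u = 0 else S (fpsC (c ^- n) * u)].

Lemma fpsC_ratr_invn n : fpsC (ratr n%:R^-1) = n%:R^-1 :> fps C.
Proof. by rewrite fpsC_invn (fmorphV (@ratr C)) rmorph_nat. Qed.

Lemma Qdegree_grading : grading Qdegree.
Proof.
have [S1 _ SM] := hS; split; rewrite /Qdegree /=.
- by move=> n; case: ifP => // _; rewrite mulr0; apply: Qsubalg0.
- by rewrite invr1 rmorph1 mulr1.
- move=> n u v; case: ifP => _ => [-> ->|Su Sv]; first by rewrite subr0.
  by rewrite mulrBr; apply: QsubalgB.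
- move=> m n u v; rewrite oddD; do 2 case: ifP => _ /=.
  + by move=> -> ->; rewrite mulr0 mulr0; apply: Qsubalg0.
  + by move=> -> _; rewrite mul0r.
  + by move=> _ ->; rewrite mulr0.
  + by move=> Su Sv; rewrite exprD invfM rmorphM mulrACA; apply: SM.
- move=> i n u; case: ifP => _ => [->|Su]; first by rewrite mulr0.
  by rewrite -fpsC_ratr_invn mulrCA; apply: QsubalgZ.
Qed.

Lemma QdegreeE n (a : rat) u : a != 0 -> ~~ odd n ->
  Qdegree n (fpsC (c ^+ n * ratr a) * u) <-> S u.
Proof.
move=> a0 /negbTE on; rewrite /Qdegree /= on mulrA -rmorphM mulKf ?expf_neq0 ?c_neq0 //.
by split; [apply: QsubalgZ_inv|apply: QsubalgZ].
Qed.

Lemma graded_sinc : graded Qdegree sinc.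
Proof.
move=> n; rewrite /= ; case: ifP => on; first by apply: grading0; exact: Qdegree_grading.
rewrite -[fpsC _]mulr1; apply/QdegreeE; rewrite ?on //; last by case: hS.
by rewrite invr_neq0 // pnatr_eq0 muln_eq0 negb_or expn_eq0 -lt0n fact_gt0.
Qed.

End QsubalgebraTheory.

(** * Transfer between moments and mock Eisenstein series *)

Variable f : nat -> fps C.
Hypothesis hf : is_mock_eisenstein f.

Definition moment_series : fps (fps C) :=
  Fps (fun k => fpsC (c ^+ k / k`!%:R) * normalized_rank_moment R k).

Definition mock_series : fps (fps C) := 2 * fps_sum (fun k =>
  if k is 0 then 0 else fpsC (f k / k`!%:R) * (fpsC (fpsC c) * fpsX) ^+ k).

Lemma fcoef_mock_series0 : fcoef mock_series 0 = 0.
Proof. by rewrite /mock_series mulr_natl mulr2n fcoefD /= big_ord1 fcoef0 addr0. Qed.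

Lemma fcoef_mock_series n : (0 < n)%N ->
  fcoef mock_series n = fpsC (c ^+ n * ratr (2 / n`!%:R)) * f n.
Proof.
case: n => // n _; rewrite /mock_series -(rmorph_nat (@fpsC _)) fcoefCM fcoef_fps_sum.
rewrite big_ord_recl fcoef0 add0r big_ord_recr !lift0.
rewrite big1 ?Monoid.mul1m => [|i _].
  rewrite fcoefCM fcoefCXn eqxx mulr1 -(rmorphXn (@fpsC C)) [in RHS]fpsCM.
  have -> : fpsC (ratr (2 / n.+1`!%:R)) = 2 * n.+1`!%:R^-1 :> fps C.
    by rewrite -fpsC_ratr_invn -(rmorph_nat (@fpsC C)) -(rmorph_nat (@ratr C)) -!rmorphM.
  ring.
by rewrite fcoefCM fcoefCXn !lift0 eqSS /= gtn_eqF ?mulr0.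
Qed.

Lemma moment_seriesE : moment_series = sinc * fps_exp mock_series.
Proof.
apply: (fpsCCX_inj piC_neq0); rewrite [RHS]mulrA -fps_sinE -hf -[RHS]mulrA.
congr (_ * _); apply: fpsP => k; rewrite fcoefCM fcoef_rank_gf /=.
by rewrite /normalized_rank_moment mulrCA.
Qed.

Lemma graded_moment_mock S : is_Qsubalgebra S ->
  graded (Qdegree S) moment_series <-> graded (Qdegree S) mock_series.
Proof.
move=> hS; have gS := Qdegree_grading hS.
rewrite -(graded_exp gS fcoef_mock_series0) moment_seriesE; split.
  apply: (gradedMr gS) (graded_sinc hS).
  by rewrite /= expr0 mul1r expn0 mul1n invr1 !rmorph1.
exact/(gradedM gS)/graded_sinc.
Qed.

Lemma graded_moment_seriesP S : is_Qsubalgebra S ->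
  (forall k, (1 <= k)%N -> S (normalized_rank_moment R (2 * k))) <->
  graded (Qdegree S) moment_series.
Proof.
move=> hS; have gS := Qdegree_grading hS.
have E n : fcoef moment_series n =
    fpsC (c ^+ n * ratr (n`!%:R^-1)) * normalized_rank_moment R n.
  by rewrite (fmorphV (@ratr C)) rmorph_nat.
have f0 n : n`!%:R^-1 != 0 :> rat by rewrite invr_neq0 ?natf_fact_neq0.
split=> [SR n|gM k _]; last first.
  by have := gM (2 * k)%N; rewrite E => /QdegreeE; apply; rewrite // mul2n odd_double.
have [on|on] := boolP (odd n).
  rewrite E /normalized_rank_moment odd_rank_moment_gf // !mulr0.
  exact: grading0.
have -> : n = (2 * n./2)%N by rewrite mul2n -[LHS]odd_double_half (negbTE on).
case: (n./2) => [|k].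
  have -> : fcoef moment_series (2 * 0) = 1.
    rewrite moment_seriesE muln0 fcoefM big_ord1 subnn fcoef_exp0 mulr1.
    by rewrite /= expr0 mul1r expn0 mul1n invr1 !rmorph1.
  by rewrite muln0; apply: grading1.
by rewrite E; apply/(QdegreeE hS); [exact: f0|rewrite mul2n odd_double|apply: SR].
Qed.

Lemma graded_mock_seriesP S : is_Qsubalgebra S ->
  ((forall n, odd n -> f n = 0) /\ (forall k, (1 <= k)%N -> S (f (2 * k)%N))) <->
  graded (Qdegree S) mock_series.
Proof.
move=> hS; have gS := Qdegree_grading hS.
have f0 n : 2 / n`!%:R != 0 :> rat by rewrite mulf_neq0 ?invr_neq0 ?natf_fact_neq0.
split=> [[fo SF] [|n]|gF].
- by rewrite fcoef_mock_series0; apply: grading0.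
- rewrite fcoef_mock_series //; have [on|on] := boolP (odd n.+1).
    by rewrite fo // mulr0; apply: grading0.
  apply/(QdegreeE hS) => //.
  have -> : n.+1 = (2 * n.+1./2)%N by rewrite mul2n -[LHS]odd_double_half (negbTE on).
  by apply: SF; case: n on => [|[]].
split=> [n on|k k0].
  have := gF n; rewrite fcoef_mock_series ?odd_gt0 // /Qdegree /= on.
  move=> /(congr1 (fun u => fpsC (c ^+ n * ratr (2 / n`!%:R))^-1 * u)).
  rewrite mulr0 mulrA -rmorphM mulVf ?rmorph1 ?mul1r //.
  by rewrite mulf_neq0 ?expf_neq0 ?c_neq0 // fmorph_eq0.
have := gF (2 * k)%N; rewrite fcoef_mock_series ?muln_gt0 //.
by move=> /QdegreeE; apply; rewrite // mul2n odd_double.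
Qed.

Lemma Qsubalg_rank_moment_mock S : is_Qsubalgebra S ->
  (forall k, (1 <= k)%N -> S (normalized_rank_moment R (2 * k))) <->
  (forall k, (1 <= k)%N -> S (f (2 * k)%N)).
Proof.
move=> hS; rewrite graded_moment_seriesP // graded_moment_mock // -graded_mock_seriesP //.
split=> [[]//|Sf]; split=> //.
(* Over the full ring, gradedness only says that odd coefficients vanish; transferring it shows that
   the odd [f n] are 0. *)
have hT : is_Qsubalgebra [set: fps C] by split.
have : graded (Qdegree setT) moment_series by apply/graded_moment_seriesP.
by rewrite graded_moment_mock // -graded_mock_seriesP // => -[].
Qed.

End MockEisenstein.

Lemma Qalgebra_is_Qsubalgebra (R : realType) (X : set (fps R[i])) :
  is_Qsubalgebra (Qalgebra X).
Proof.
split=> [S [[]//]|a u v Xu Xv S hS|u v Xu Xv S hS].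
  by have [[_ SL _] XS] := hS; apply: SL; [apply: Xu|apply: Xv].
by have [[_ _ SM] XS] := hS; apply: SM; [apply: Xu|apply: Xv].
Qed.

Theorem mainTheorem7 (R : realType) (f : nat -> fps R[i])
    (hf : is_mock_eisenstein f) :
  Qalgebra ([set normalized_rank_moment R (2 * k)%N | k in [set k | (1 <= k)%N]]
            `|` [set eisenstein R (2 * k)%N | k in [set k | (1 <= k)%N]])
  = Qalgebra ([set f (2 * k)%N | k in [set k | (1 <= k)%N]]
              `|` [set eisenstein R (2 * k)%N | k in [set k | (1 <= k)%N]]).
Proof.
apply/seteqP; split; (apply: smallest_sub; first exact: Qalgebra_is_Qsubalgebra).
- move=> u [[k /= k1 <-]|Gu]; last by apply: sub_gen_smallest; right.
  (* The equivalence is used in the algebra generated by the [f (2 * k)] and the Eisenstein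
     series. *)
  apply: (Qsubalg_rank_moment_mock hf (Qalgebra_is_Qsubalgebra _)).2 k1 => j j1.
  by apply: sub_gen_smallest; left; exists j.
- move=> u [[k /= k1 <-]|Gu]; last by apply: sub_gen_smallest; right.
  apply: (Qsubalg_rank_moment_mock hf (Qalgebra_is_Qsubalgebra _)).1 k1 => j j1.
  by apply: sub_gen_smallest; left; exists j.
Qed.
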